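(* Let $\hat{\mathbf Q}=\tilde{\mathbf Q}_{\mathrm{st}}+\tilde{\mathbf Q}_{\mathcal I}\epsilon\in\hat{\mathbb Q}^{n\times n}$ be a dual quaternion Hermitian matrix with eigenvalues $\lambda_1,\dots,\lambda_n$ (dual numbers) and corresponding orthonormal eigenvectors $\hat{\mathbf u}_1,\dots,\hat{\mathbf u}_n$, and let $\hat{\mathbf v}^{(0)}=\sum_{j=1}^n\hat{\mathbf u}_j\hat\alpha_j$ (with $\hat\alpha_j=\tilde\alpha_{j,\mathrm{st}}+\tilde\alpha_{j,\mathcal I}\epsilon\in\hat{\mathbb Q}$) be a dual quaternion vector with unit $2$-norm. Suppose that $\sum_{j=1}^l|\tilde\alpha_{j,\mathrm{st}}|\neq0$, that $\tilde{\mathbf Q}_{\mathrm{st}}\neq\mathbf O$, and that $\hat{\mathbf Q}$ has a strict dominant eigenvalue with multiplicity $l$, i.e. $$\lambda_1=\dots=\lambda_l\quad\text{and}\quad |\lambda_{1,\mathrm{st}}|>|\lambda_{l+1,\mathrm{st}}|\ge\dots\ge|\lambda_{n,\mathrm{st}}|\ge0 .$$ Let the power method sequences be defined for $k\ge1$ by $$\hat{\mathbf y}^{(k)}=\hat{\mathbf Q}\hat{\mathbf v}^{(k-1)},\qquad \lambda^{(k-1)}=(\hat{\mathbf v}^{(k-1)})^*\hat{\mathbf y}^{(k)},\qquad \hat{\mathbf v}^{(k)}=\frac{\hat{\mathbf y}^{(k)}}{\|\hat{\mathbf y}^{(k)}\|_2}.$$ Put $s=\mathrm{sgn}(\lambda_{1,\mathrm{st}})$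 and $\hat\gamma_j=\hat\alpha_j\big/\sqrt{\sum_{i=1}^l|\hat\alpha_i|^2}$ for $j=1,\dots,l$. Then $$\hat{\mathbf v}^{(k)}=s^k\sum_{j=1}^l\hat{\mathbf u}_j\hat\gamma_j\left(1_D+\tilde O_D\!\left(\left|\frac{\lambda_{l+1,\mathrm{st}}}{\lambda_{1,\mathrm{st}}}\right|^{k}\right)\right)$$ and $$\lambda^{(k)}=(\hat{\mathbf v}^{(k)})^*\hat{\mathbf y}^{(k+1)}=\lambda_1\left(1_D+\tilde O_D\!\left(\left|\frac{\lambda_{l+1,\mathrm{st}}}{\lambda_{1,\mathrm{st}}}\right|^{2k}\right)\right).$$ In other words, the sequence $\hat{\mathbf v}^{(k)}s^k$ converges to a strict dominant eigenvector $\sum_{j=1}^l\hat{\mathbf u}_j\hat\gamma_j$ at a rate of $\tilde O_D\big(|\lambda_{l+1,\mathrm{st}}/\lambda_{1,\mathrm{st}}|^k\big)$, and the sequence $\lambda^{(k)}$ converges to the strict dominant eigenvalue $\lambda_1$ at a rate of $\tilde O_D\big(|\lambda_{l+1,\mathrm{st}}/\lambda_{1,\mathrm{st}}|^{2k}\big)$.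
   Context: Dual numbers: $a=a_{\mathrm{st}}+a_{\mathcal I}\epsilon$, $a_{\mathrm{st}},a_{\mathcal I}\in\mathbb R$, $\epsilon\neq0$, $\epsilon^2=0$; $1_D=1+0\epsilon$. If $a_{\mathrm{st}}>0$, $\sqrt a=\sqrt{a_{\mathrm{st}}}+\frac{a_{\mathcal I}}{2\sqrt{a_{\mathrm{st}}}}\epsilon$. $\mathbb Q$ is the set of real (Hamilton) quaternions with conjugate $\tilde q^*$, magnitude $|\tilde q|$, scalar part $sc(\tilde q)=\frac12(\tilde q+\tilde q^* )$. Dual quaternions $\hat{\mathbb Q}$: $\hat q=\tilde q_{\mathrm{st}}+\tilde q_{\mathcal I}\epsilon$, $\tilde q_{\mathrm{st}},\tilde q_{\mathcal I}\in\mathbb Q$, with $\epsilon$ commuting with quaternions, and $\hat q^*=\tilde q_{\mathrm{st}}^*+\tilde q_{\mathcal I}^*\epsilon$; the subscripts st and $\mathcal I$ denote the standard and dual parts. The magnitude is $|\hat q|=|\tilde q_{\mathrm{st}}|+\frac{sc(\tilde q_{\mathrm{st}}^*\tilde q_{\mathcal I})}{|\tilde q_{\mathrm{st}}|}\epsilon$ if $\tilde q_{\mathrm{st}}\neq\tilde0$, and $|\tilde q_{\mathcal I}|\epsilon$ otherwise. The $2$-norm of $\hat{\mathbf x}=\tilde{\mathbf x}_{\mathrm{st}}+\tilde{\mathbf x}_{\mathcal I}\epsilon\in\hat{\mathbb Q}^{n\times1}$ is $\sqrt{\sum_i|\hat x_i|^2}$ if $\tilde{\mathbf x}_{\mathrm{st}}\ne\mathbf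 0$ and $\sqrt{\sum_i|\tilde x_{i,\mathcal I}|^2}\,\epsilon$ otherwise. For a dual number $a$ with $a_{\mathrm{st}}\neq0$, $\frac{\hat q}{a}=\frac{\tilde q_{\mathrm{st}}}{a_{\mathrm{st}}}+\left(\frac{\tilde q_{\mathcal I}}{a_{\mathrm{st}}}-\frac{\tilde q_{\mathrm{st}}}{a_{\mathrm{st}}}\frac{a_{\mathcal I}}{a_{\mathrm{st}}}\right)\epsilon$, entrywise for vectors. $\hat{\mathbf Q}$ is Hermitian if it equals its conjugate transpose $\hat{\mathbf Q}^*$. An eigenvalue of $\hat{\mathbf Q}$ is a dual number $\lambda$ with $\hat{\mathbf Q}\hat{\mathbf u}=\hat{\mathbf u}\lambda$ for some $\hat{\mathbf u}$ with nonzero standard part (an eigenvector). It is known that an $n\times n$ dual quaternion Hermitian matrix has exactly $n$ eigenvalues (with multiplicity), all dual numbers, and $n$ eigenvectors with $\hat{\mathbf Q}\hat{\mathbf u}_i=\hat{\mathbf u}_i\lambda_i$, $\hat{\mathbf u}_i^*\hat{\mathbf u}_j=\hat 1$ if $i=j$ and $\hat0$ otherwise, forming an orthonormal basis of $\hat{\mathbb Q}^{n\times1}$. A strict dominant eigenvector is an eigenvector corresponding to the strict dominant eigenvalue $\lambda_1$. Asymptotic notation: for a positive real number $c<1$, a real sequence is $\tilde O(c^k)$ if it is $O(c^kh(k))$ for some polynomial $h$. A dual number sequence $a_k$ is $\tilde O_D(c^k)$ if both $a_{k,\mathrm{st}}$ and $a_{k,\mathcal I}$ are $\tilde O(c^k)$.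 A dual number sequence converges if both its standard part sequence and its dual part sequence converge; likewise for dual quaternion vectors.
   Formalization: The first displayed formula, which read literally puts v^(k) in the span of u_1,…,u_l (false for Q = diag(2,1), v^(0) = (e_1+e_2)/√2), is stated with an added remainder: a sum over j>l of u_j times dual quaternion coefficients of order Õ_D(|λ_{l+1,st}/λ_{1,st}|^k). *)

(* Defs.v *)
From HB Require Import structures.
From mathcomp Require Import all_boot all_order all_algebra.
From mathcomp Require Import ring.
From mathcomp Require Import all_classical all_reals all_analysis.
Import Order.TTheory GRing.Theory Num.Theory.
Import numFieldNormedType.Exports.

Set Implicit Arguments.
Unset Strict Implicit.
Unset Printing Implicit Defensive.

Local Open Scope ring_scope.

(** * Quaternions *)

(* [Quat a b c d] is a + b i + c j + d k. *)
Record quat (R : Type) := Quat { qre : R; qi : R; qj : R; qk : R }.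

Definition quat_tuple (R : Type) (q : quat R) : R * R * R * R :=
  (qre q, qi q, qj q, qk q).
Definition tuple_quat (R : Type) (t : R * R * R * R) : quat R :=
  Quat t.1.1.1 t.1.1.2 t.1.2 t.2.
Lemma quat_tupleK (R : Type) : cancel (@quat_tuple R) (@tuple_quat R).
Proof. by case. Qed.

HB.instance Definition _ (R : eqType) :=
  Equality.copy (quat R) (can_type (@quat_tupleK R)).
HB.instance Definition _ (R : choiceType) :=
  Choice.copy (quat R) (can_type (@quat_tupleK R)).

Definition addq (R : zmodType) (p q : quat R) : quat R :=
  Quat (qre p + qre q) (qi p + qi q) (qj p + qj q) (qk p + qk q).
Definition oppq (R : zmodType) (q : quat R) : quat R :=
  Quat (- qre q) (- qi q) (- qj q) (- qk q).

Lemma addqA (R : zmodType) : associative (@addq R).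
Proof. by case=> ? ? ? ? [? ? ? ?] [? ? ? ?]; rewrite /addq /= !addrA. Qed.
Lemma addqC (R : zmodType) : commutative (@addq R).
Proof.
case=> a b c d [a' b' c' d'].
by rewrite /addq /= (addrC a) (addrC b) (addrC c) (addrC d).
Qed.
Lemma add0q (R : zmodType) : left_id (Quat 0 0 0 0) (@addq R).
Proof. by case=> ? ? ? ?; rewrite /addq /= !add0r. Qed.
Lemma addNq (R : zmodType) : left_inverse (Quat 0 0 0 0) (@oppq R) (@addq R).
Proof. by case=> ? ? ? ?; rewrite /addq /= !addNr. Qed.

HB.instance Definition _ (R : zmodType) :=
  GRing.isZmodule.Build (quat R) (@addqA R) (@addqC R) (@add0q R) (@addNq R).

Definition mulq (R : comNzRingType) (p q : quat R) : quat R :=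
  let: Quat a b c d := p in let: Quat a' b' c' d' := q in
  Quat (a * a' - b * b' - c * c' - d * d')
       (a * b' + b * a' + c * d' - d * c')
       (a * c' - b * d' + c * a' + d * b')
       (a * d' + b * c' - c * b' + d * a').

Lemma mulqA (R : comNzRingType) : associative (@mulq R).
Proof. by case=> ? ? ? ? [? ? ? ?] [? ? ? ?]; congr Quat => /=; ring. Qed.
Lemma mul1q (R : comNzRingType) : left_id (Quat 1 0 0 0) (@mulq R).
Proof. by case=> ? ? ? ?; congr Quat => /=; ring. Qed.
Lemma mulq1 (R : comNzRingType) : right_id (Quat 1 0 0 0) (@mulq R).
Proof. by case=> ? ? ? ?; congr Quat => /=; ring. Qed.
Lemma mulqDl (R : comNzRingType) : left_distributive (@mulq R) +%R.
Proof. by case=> ? ? ? ? [? ? ? ?] [? ? ? ?]; congr Quat => /=; ring. Qed.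
Lemma mulqDr (R : comNzRingType) : right_distributive (@mulq R) +%R.
Proof. by case=> ? ? ? ? [? ? ? ?] [? ? ? ?]; congr Quat => /=; ring. Qed.
Lemma quat1_neq0 (R : comNzRingType) : Quat 1 0 0 0 != 0 :> quat R.
Proof. by apply/eqP => -[] /eqP; rewrite oner_eq0. Qed.

HB.instance Definition _ (R : comNzRingType) :=
  GRing.Zmodule_isNzRing.Build (quat R) (@mulqA R) (@mul1q R) (@mulq1 R)
    (@mulqDl R) (@mulqDr R) (@quat1_neq0 R).

Definition scaleq (R : comNzRingType) (r : R) (q : quat R) : quat R :=
  Quat (r * qre q) (r * qi q) (r * qj q) (r * qk q).

Lemma scaleqA (R : comNzRingType) (a b : R) (q : quat R) :
  scaleq a (scaleq b q) = scaleq (a * b) q.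
Proof. by rewrite /scaleq /= !mulrA. Qed.
Lemma scale1q (R : comNzRingType) : left_id 1 (@scaleq R).
Proof. by case=> ? ? ? ?; rewrite /scaleq /= !mul1r. Qed.
Lemma scaleqDr (R : comNzRingType) : right_distributive (@scaleq R) +%R.
Proof. by move=> ? [? ? ? ?] [? ? ? ?]; congr Quat => /=; ring. Qed.
Lemma scaleqDl (R : comNzRingType) (q : quat R) :
  {morph (@scaleq R)^~ q : a b / a + b}.
Proof. by move=> ? ?; case: q => ? ? ? ?; congr Quat => /=; ring. Qed.

HB.instance Definition _ (R : comNzRingType) :=
  GRing.Zmodule_isLmodule.Build R (quat R) (@scaleqA R) (@scale1q R)
    (@scaleqDr R) (@scaleqDl R).

Definition qreal (R : zmodType) (r : R) : quat R := Quat r 0 0 0.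

Definition qconj (R : zmodType) (q : quat R) : quat R :=
  Quat (qre q) (- qi q) (- qj q) (- qk q).

(* The scalar part (q + qconj q)/2, as an element of R; see [qscE]. *)
Definition qsc (R : zmodType) (q : quat R) : R := qre q.

Lemma qscE (R : realType) (q : quat R) :
  qreal (qsc q) = 2^-1 *: (q + qconj q).
Proof. by case: q => ? ? ? ?; congr Quat => /=; field. Qed.

Definition qabs (R : realType) (q : quat R) : R :=
  Num.sqrt (qre q ^+ 2 + qi q ^+ 2 + qj q ^+ 2 + qk q ^+ 2).

(** * Dual extension of a ring: [Dual a b] is a + b eps, with eps central and
    eps^2 = 0.  Dual numbers are [dual R], dual quaternions [dual (quat R)]. *)

Record dual (A : Type) := Dual { st : A; du : A }.

Definition dual_pair (A : Type) (x : dual A) : A * A := (st x, du x).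
Definition pair_dual (A : Type) (p : A * A) : dual A := Dual p.1 p.2.
Lemma dual_pairK (A : Type) : cancel (@dual_pair A) (@pair_dual A).
Proof. by case. Qed.

HB.instance Definition _ (A : eqType) :=
  Equality.copy (dual A) (can_type (@dual_pairK A)).
HB.instance Definition _ (A : choiceType) :=
  Choice.copy (dual A) (can_type (@dual_pairK A)).

Definition addd (A : zmodType) (x y : dual A) : dual A :=
  Dual (st x + st y) (du x + du y).
Definition oppd (A : zmodType) (x : dual A) : dual A := Dual (- st x) (- du x).

Lemma adddA (A : zmodType) : associative (@addd A).
Proof. by case=> ? ? [? ?] [? ?]; rewrite /addd /= !addrA. Qed.
Lemma adddC (A : zmodType) : commutative (@addd A).
Proof. by case=> a b [c d]; rewrite /addd /= (addrC a) (addrC b). Qed.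
Lemma add0d (A : zmodType) : left_id (Dual 0 0) (@addd A).
Proof. by case=> ? ?; rewrite /addd /= !add0r. Qed.
Lemma addNd (A : zmodType) : left_inverse (Dual 0 0) (@oppd A) (@addd A).
Proof. by case=> ? ?; rewrite /addd /= !addNr. Qed.

HB.instance Definition _ (A : zmodType) :=
  GRing.isZmodule.Build (dual A) (@adddA A) (@adddC A) (@add0d A) (@addNd A).

Definition muld (A : nzRingType) (x y : dual A) : dual A :=
  Dual (st x * st y) (st x * du y + du x * st y).

Lemma muldA (A : nzRingType) : associative (@muld A).
Proof.
case=> ? ? [? ?] [? ?]; rewrite /muld /=.
by congr Dual; rewrite ?mulrDl ?mulrDr !mulrA ?addrA.
Qed.
Lemma mul1d (A : nzRingType) : left_id (Dual 1 0) (@muld A).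
Proof. by case=> ? ?; rewrite /muld /= !mul1r mul0r addr0. Qed.
Lemma muld1 (A : nzRingType) : right_id (Dual 1 0) (@muld A).
Proof. by case=> ? ?; rewrite /muld /= !mulr1 mulr0 add0r. Qed.
Lemma muldDl (A : nzRingType) : left_distributive (@muld A) +%R.
Proof.
by case=> ? ? [? ?] [? ?]; congr Dual => /=; rewrite !mulrDl // addrACA.
Qed.
Lemma muldDr (A : nzRingType) : right_distributive (@muld A) +%R.
Proof.
by case=> ? ? [? ?] [? ?]; congr Dual => /=; rewrite !mulrDr // addrACA.
Qed.
Lemma dual1_neq0 (A : nzRingType) : Dual 1 0 != 0 :> dual A.
Proof. by apply/eqP => -[] /eqP; rewrite oner_eq0. Qed.

HB.instance Definition _ (A : nzRingType) :=
  GRing.Zmodule_isNzRing.Build (dual A) (@muldA A) (@mul1d A) (@muld1 A)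
    (@muldDl A) (@muldDr A) (@dual1_neq0 A).

Lemma muldC (A : comNzRingType) : commutative (@muld A).
Proof.
by case=> a b [c d]; rewrite /muld /= addrC mulrC (mulrC a d) (mulrC b c).
Qed.

HB.instance Definition _ (A : comNzRingType) :=
  GRing.PzRing_hasCommutativeMul.Build (dual A) (@muldC A).

(* Only meant for arguments with positive standard part. *)
Definition dsqrt (R : realType) (a : dual R) : dual R :=
  Dual (Num.sqrt (st a)) (du a / (2 * Num.sqrt (st a))).

(** * Dual quaternions *)

Definition dq_of_dual (R : zmodType) (a : dual R) : dual (quat R) :=
  Dual (qreal (st a)) (qreal (du a)).
Definition dq_of_real (R : zmodType) (r : R) : dual (quat R) :=
  Dual (qreal r) 0.

Definition dqconj (R : zmodType) (x : dual (quat R)) : dual (quat R) :=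
  Dual (qconj (st x)) (qconj (du x)).

Definition dqabs (R : realType) (x : dual (quat R)) : dual R :=
  if st x != 0
  then Dual (qabs (st x)) (qsc (qconj (st x) * du x) / qabs (st x))
  else Dual 0 (qabs (du x)).

(* Only meant for divisors with nonzero standard part. *)
Definition dqdiv (R : realType) (x : dual (quat R)) (a : dual R) :
    dual (quat R) :=
  Dual ((st a)^-1 *: st x)
       ((st a)^-1 *: du x - (du a / st a) *: ((st a)^-1 *: st x)).

Definition mxst (A : Type) (m n : nat) (M : 'M[dual A]_(m, n)) : 'M[A]_(m, n) :=
  map_mx (@st A) M.

Definition conjtr (R : zmodType) (m n : nat) (M : 'M[dual (quat R)]_(m, n)) :
    'M[dual (quat R)]_(n, m) :=
  map_mx (@dqconj R) M^T.

(* Scalars act on column vectors from the right; [*:] is a left action. *)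
Definition vscale (R : comNzRingType) (n : nat) (x : 'cV[dual (quat R)]_n)
    (a : dual (quat R)) : 'cV[dual (quat R)]_n :=
  map_mx (fun t => t * a) x.

Definition vdiv (R : realType) (n : nat) (x : 'cV[dual (quat R)]_n)
    (a : dual R) : 'cV[dual (quat R)]_n :=
  map_mx (fun t => dqdiv t a) x.

Definition norm2 (R : realType) (n : nat) (x : 'cV[dual (quat R)]_n) : dual R :=
  if mxst x != 0
  then dsqrt (\sum_i dqabs (x i 0) ^+ 2)
  else Dual 0 (Num.sqrt (\sum_i qabs (du (x i 0)) ^+ 2)).

Definition dqhermitian (R : zmodType) (n : nat) (Q : 'M[dual (quat R)]_n) : Prop :=
  Q = conjtr Q.

Definition is_eigenvector (R : comNzRingType) (n : nat)
    (Q : 'M[dual (quat R)]_n) (a : dual R) (u : 'cV[dual (quat R)]_n) : Prop :=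
  mxst u != 0 /\ Q *m u = vscale u (dq_of_dual a).

Definition dqorthonormal (R : comNzRingType) (n : nat)
    (u : 'I_n -> 'cV[dual (quat R)]_n) : Prop :=
  forall i j, (conjtr (u i) *m u j) 0 0 = (i == j)%:R.

(* Eigenvalues are indexed from 0: the mathematical lambda_1 is [lam ord0] and
   lambda_(l+1) is the entry of index l.  When l is the full order n.+1 there
   is no lambda_(l+1); its standard part is then taken to be 0. *)
Definition next_st (R : zmodType) (n : nat) (lam : 'I_n.+1 -> dual R)
    (l : nat) : R :=
  if insub l is Some i then st (lam i) else 0.

Definition strict_dominant (R : realType) (n : nat)
    (lam : 'I_n.+1 -> dual R) (l : nat) : Prop :=
  [/\ (0 < l <= n.+1)%N,
      forall j : 'I_n.+1, (j < l)%N -> lam j = lam ord0,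
      `|next_st lam l| < `|st (lam ord0)| &
      forall i j : 'I_n.+1, (l <= i <= j)%N -> `|st (lam j)| <= `|st (lam i)| ].

(** * Rates and convergence *)

Local Open Scope classical_set_scope.

(* a_k = O~(g_k): the rate is given by the whole sequence g, e.g. g_k = c^k. If
   g is eventually 0 (rate c = 0), this says that a is eventually 0. *)
Definition Otilde (R : realType) (g a : nat -> R) : Prop :=
  exists h : {poly R},
    (a : nat -> R^o) =O_\oo ((fun k => g k * h.[k%:R]) : nat -> R^o).

Definition OtildeD (R : realType) (g : nat -> R) (a : nat -> dual R) : Prop :=
  Otilde g (fun k => st (a k)) /\ Otilde g (fun k => du (a k)).

Definition OtildeDQ (R : realType) (g : nat -> R)
    (x : nat -> dual (quat R)) : Prop :=
  Otilde g (fun k => qabs (st (x k))) /\ Otilde g (fun k => qabs (du (x k))).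

Definition OtildeDV (R : realType) (n : nat) (g : nat -> R)
    (x : nat -> 'cV[dual (quat R)]_n) : Prop :=
  forall i, OtildeDQ g (fun k => x k i 0).

Definition qcvg (R : realType) (q : nat -> quat R) (p : quat R) : Prop :=
  (fun k => qabs (q k - p)) @ \oo --> (0 : R).

Definition dqcvg (R : realType) (x : nat -> dual (quat R))
    (y : dual (quat R)) : Prop :=
  qcvg (fun k => st (x k)) (st y) /\ qcvg (fun k => du (x k)) (du y).

Definition dvcvg (R : realType) (n : nat) (x : nat -> 'cV[dual (quat R)]_n)
    (y : 'cV[dual (quat R)]_n) : Prop :=
  forall i, dqcvg (fun k => x k i 0) (y i 0).

(* Main.v *)
Require Import Defs.
From HB Require Import structures.
From mathcomp Require Import all_boot all_order all_algebra.
From mathcomp Require Import ring lra.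
From mathcomp Require Import all_classical all_reals all_analysis.
Import Order.TTheory GRing.Theory Num.Theory.
Import numFieldNormedType.Exports.

Set Implicit Arguments.
Unset Strict Implicit.
Unset Printing Implicit Defensive.

(** The iterates have a closed form.  Put r_j = lambda_j / lambda_1 and
    T_k = sum_j |alpha_j|^2 r_j^(2k), a dual number whose standard part is
    positive.  Since Q acts diagonally on the orthonormal eigenvectors, and since
    the squared norm of a combination of orthonormal vectors is the sum of the
    squared magnitudes of its coefficients, each step multiplies the j-th
    coefficient by lambda_j and renormalizes; as lambda_1 = s |lambda_1|,
    induction on k gives ([power_method_iterates])

      v_k = sum_j u_j alpha_j s^k r_j^k / sqrt T_k.

    All the dual numbers here are central among the dual quaternions, so that
    quaternions only enter through the fixed coefficients alpha_j and u_j.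

    For j < l the ratio r_j is 1, hence T_k = A + E_k, where
    A = sum_(j < l) |alpha_j|^2 is the square of the normalizer in gamma_j and
    E_k collects the other terms.  The first l coefficients of v_k are thus
    s^k gamma_j sqrt A / sqrt (A + E_k), and the remaining ones are multiples of
    r_j^k.  The Rayleigh quotient equals

      lambda_1 (1 + sum_(j >= l) |alpha_j|^2 (r_j - 1) r_j^(2k) / T_k).

    The rates then come from the powers of a dual number: if |st r| <= c, the
    dual part k (st r)^(k-1) (du r) of r^k is c^k up to a polynomial factor
    ([rateD_exprn]).  If c = 0, it vanishes for k >= 2, so the estimates hold in
    this degenerate case too.  Hence E_k has rate c^(2k), and so has the relative
    error sqrt A / sqrt (A + E_k) - 1 ([rateD_sqrt_ratio]).  Convergence follows
    because a polynomial times c^k tends to 0 for c < 1. *)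

Local Open Scope ring_scope.

(** * Dual numbers inside the dual quaternions *)

Lemma dual_eqP (A : Type) (x y : dual A) : st x = st y -> du x = du y -> x = y.
Proof. by case: x y => [? ?] [? ?] /= -> ->. Qed.

Lemma st_is_zmod_morphism (A : zmodType) : zmod_morphism (@st A).
Proof. by []. Qed.
HB.instance Definition _ (A : zmodType) :=
  GRing.isZmodMorphism.Build (dual A) A (@st A) (@st_is_zmod_morphism A).
Lemma st_is_monoid_morphism (A : nzRingType) : monoid_morphism (@st A).
Proof. by []. Qed.
HB.instance Definition _ (A : nzRingType) :=
  GRing.isMonoidMorphism.Build (dual A) A (@st A) (@st_is_monoid_morphism A).

Lemma stX (A : nzRingType) (x : dual A) k : st (x ^+ k) = st x ^+ k.
Proof. exact: (rmorphXn (@st A)). Qed.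

Lemma st_sum (A : zmodType) (I : Type) (r : seq I) (P : pred I) (F : I -> dual A) :
  st (\sum_(i <- r | P i) F i) = \sum_(i <- r | P i) st (F i).
Proof. exact: (raddf_sum (@st A)). Qed.

Lemma dq_of_dual_is_zmod_morphism (R : zmodType) :
  zmod_morphism (@dq_of_dual R).
Proof. by move=> x y; apply: dual_eqP; congr Quat => /=; rewrite subr0. Qed.
HB.instance Definition _ (R : zmodType) :=
  GRing.isZmodMorphism.Build (dual R) (dual (quat R)) (@dq_of_dual R)
    (@dq_of_dual_is_zmod_morphism R).
Lemma dq_of_dual_is_monoid_morphism (R : comNzRingType) :
  monoid_morphism (@dq_of_dual R).
Proof. by split=> // x y; apply: dual_eqP; congr Quat => /=; ring. Qed.
HB.instance Definition _ (R : comNzRingType) :=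
  GRing.isMonoidMorphism.Build (dual R) (dual (quat R)) (@dq_of_dual R)
    (@dq_of_dual_is_monoid_morphism R).

Lemma dq_of_dual_inj (R : zmodType) : injective (@dq_of_dual R).
Proof. by move=> [a b] [a' b'] [-> ->]. Qed.

(** This centrality is what lets every real or dual factor be collected at the
    end of a product of dual quaternions. *)
Lemma dq_of_dualC (R : comNzRingType) (a : dual R) x :
  dq_of_dual a * x = x * dq_of_dual a.
Proof.
case: a x => [a b] [[? ? ? ?] [? ? ? ?]].
by apply: dual_eqP; congr Quat => /=; ring.
Qed.

Lemma dqconj_is_zmod_morphism (R : zmodType) : zmod_morphism (@dqconj R).
Proof. by move=> x y; apply: dual_eqP; congr Quat => /=; rewrite opprD. Qed.
HB.instance Definition _ (R : zmodType) :=
  GRing.isZmodMorphism.Build (dual (quat R)) (dual (quat R)) (@dqconj R)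
    (@dqconj_is_zmod_morphism R).

Lemma dqconjM (R : comNzRingType) (x y : dual (quat R)) :
  dqconj (x * y) = dqconj y * dqconj x.
Proof.
case: x y => [[? ? ? ?] [? ? ? ?]] [[? ? ? ?] [? ? ? ?]].
by apply: dual_eqP; congr Quat => /=; ring.
Qed.

Lemma dqconj_dq_of_dual (R : zmodType) (a : dual R) :
  dqconj (dq_of_dual a) = dq_of_dual a.
Proof. by apply: dual_eqP; congr Quat => /=; rewrite oppr0. Qed.

Lemma qabs_sqr (R : realType) (q : quat R) :
  qabs q ^+ 2 = qre q ^+ 2 + qi q ^+ 2 + qj q ^+ 2 + qk q ^+ 2.
Proof. by rewrite sqr_sqrtr// !addr_ge0// sqr_ge0. Qed.

Lemma qabs_eq0 (R : realType) (q : quat R) : (qabs q == 0) = (q == 0).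
Proof.
apply/eqP/eqP => [|->]; last by rewrite /qabs /= expr0n !addr0 sqrtr0.
move/(congr1 (fun x => x ^+ 2)); rewrite qabs_sqr expr0n/=.
case: q => a b c d /= /eqP; rewrite !paddr_eq0 ?addr_ge0 ?sqr_ge0// !sqrf_eq0.
by move=> /andP[/andP[/andP[/eqP-> /eqP->] /eqP->] /eqP->].
Qed.

(** The branch with zero standard part needs no exception: there both sides
    vanish because eps^2 = 0.  Squared magnitudes can therefore be computed
    by ring identities, without any case distinction. *)
Lemma mul_dqconj (R : realType) (x : dual (quat R)) :
  dqconj x * x = dq_of_dual (dqabs x ^+ 2).
Proof.
rewrite /dqabs; case: ifPn => [x0|/negPn/eqP].
  have q0 : qabs (st x) != 0 by rewrite qabs_eq0.
  have -> : Dual (qabs (st x)) (qsc (qconj (st x) * du x) / qabs (st x)) ^+ 2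
      = Dual (qabs (st x) ^+ 2) (2 * qsc (qconj (st x) * du x)).
    by apply: dual_eqP => //=; field.
  rewrite qabs_sqr; case: x {x0 q0} => [[? ? ? ?] [? ? ? ?]].
  by apply: dual_eqP; congr Quat => /=; ring.
case: x => [_ [? ? ? ?]] /= ->.
by apply: dual_eqP; congr Quat => /=; ring.
Qed.

Lemma dqabs_sqrM (R : realType) (x : dual (quat R)) (a : dual R) :
  dqabs (x * dq_of_dual a) ^+ 2 = dqabs x ^+ 2 * a ^+ 2.
Proof.
apply: dq_of_dual_inj; rewrite -mul_dqconj dqconjM dqconj_dq_of_dual.
rewrite mulrA -(mulrA _ (dqconj x)) mul_dqconj -!rmorphM.
by congr dq_of_dual; ring.
Qed.

Lemma st_dqabs (R : realType) (x : dual (quat R)) : st (dqabs x) = qabs (st x).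
Proof.
rewrite /dqabs; case: ifPn => // /negPn/eqP ->.
by apply/esym/eqP; rewrite qabs_eq0.
Qed.

(** The reciprocal of a + b eps is 1/a - (b/a^2) eps. *)
Definition dual_inv (R : fieldType) (a : dual R) : dual R :=
  Dual (st a)^-1 (- (du a / st a / st a)).

Lemma dual_mulV (R : fieldType) (a : dual R) : st a != 0 -> a * dual_inv a = 1.
Proof. by move=> a0; apply: dual_eqP => /=; field. Qed.

Lemma dual_inv_uniq (R : fieldType) (a b : dual R) : a * b = 1 -> dual_inv a = b.
Proof.
move=> ab; have a0 : st a != 0.
  apply/eqP => a0; have := congr1 (@st R) ab; rewrite /= a0 mul0r => /eqP.
  by rewrite eq_sym oner_eq0.
by rewrite -[LHS]mulr1 -ab mulrA [dual_inv a * a]mulrC dual_mulV// mul1r.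
Qed.

Lemma dqdivE (R : realType) (x : dual (quat R)) (a : dual R) :
  dqdiv x a = x * dq_of_dual (dual_inv a).
Proof.
case: x => [[? ? ? ?] [? ? ? ?]].
by apply: dual_eqP; congr Quat => /=; ring.
Qed.

Lemma dsqrt_sqr (R : realType) (a : dual R) : 0 < st a -> dsqrt a ^+ 2 = a.
Proof.
move=> a0; apply: dual_eqP => /=; first by rewrite -expr2 sqr_sqrtr ?ltW.
have : Num.sqrt (st a) != 0 by rewrite gt_eqF ?sqrtr_gt0.
by move=> ?; field.
Qed.

(** Square roots with positive standard part are unique; this identifies the
    norm of an iterate once its square is known. *)
Lemma dsqrt_of_sqr (R : realType) (a : dual R) : 0 < st a -> dsqrt (a ^+ 2) = a.
Proof.
move=> a0; apply: dual_eqP; rewrite /= -expr2 sqrtr_sqr gtr0_norm//.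
by have : st a != 0 by [rewrite gt_eqF]; move=> ?; field.
Qed.

(** * Combinations of orthonormal vectors *)

Definition combination (R : comNzRingType) (m n : nat)
    (u : 'I_m -> 'cV[dual (quat R)]_n) (b : 'I_m -> dual (quat R)) :=
  \sum_j vscale (u j) (b j).

(** Right scaling is a matrix product, hence inherits linearity and
    associativity, although the coefficients do not commute. *)
Lemma vscale_mulmx (R : comNzRingType) (n : nat) (x : 'cV[dual (quat R)]_n) a :
  vscale x a = x *m a%:M.
Proof.
by apply/colP => i; rewrite !mxE big_ord1 !mxE mulr1n.
Qed.

Lemma vscale_sumr (R : comNzRingType) (m n : nat) (P : pred 'I_m)
    (u : 'I_m -> 'cV[dual (quat R)]_n) a :
  vscale (\sum_(j | P j) u j) a = \sum_(j | P j) vscale (u j) a.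
Proof.
by rewrite vscale_mulmx mulmx_suml; apply: eq_bigr => j _; rewrite vscale_mulmx.
Qed.

Lemma vscaleA (R : comNzRingType) (n : nat) (x : 'cV[dual (quat R)]_n) a b :
  vscale (vscale x a) b = vscale x (a * b).
Proof. by apply/colP => i; rewrite !mxE mulrA. Qed.

Lemma mulmx_vscale (R : comNzRingType) (m n : nat)
    (Q : 'M[dual (quat R)]_(m, n)) x a :
  Q *m vscale x a = vscale (Q *m x) a.
Proof. by rewrite !vscale_mulmx mulmxA. Qed.

Lemma vdivE (R : realType) (n : nat) (x : 'cV[dual (quat R)]_n) a :
  vdiv x a = vscale x (dq_of_dual (dual_inv a)).
Proof. by apply/colP => i; rewrite !mxE dqdivE. Qed.

Lemma conjtr_sum (R : zmodType) (m n p : nat)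
    (M : 'I_p -> 'M[dual (quat R)]_(m, n)) :
  conjtr (\sum_j M j) = \sum_j conjtr (M j).
Proof.
apply/matrixP => i k; rewrite !mxE !summxE raddf_sum.
by apply: eq_bigr => j _; rewrite !mxE.
Qed.

Lemma vscale_combination (R : comNzRingType) (m n : nat)
    (u : 'I_m -> 'cV[dual (quat R)]_n) b a :
  vscale (combination u b) a = combination u (fun j => b j * a).
Proof. by rewrite vscale_sumr; apply: eq_bigr => j _; rewrite vscaleA. Qed.

Lemma inner_vscale (R : comNzRingType) (n : nat) (x y : 'cV[dual (quat R)]_n) a b :
  (conjtr (vscale x a) *m vscale y b) 0 0 =
  dqconj a * (conjtr x *m y) 0 0 * b.
Proof.
rewrite !mxE mulr_sumr mulr_suml; apply: eq_bigr => i _.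
by rewrite !mxE dqconjM !mulrA.
Qed.

Lemma inner_combination (R : comNzRingType) (n : nat)
    (u : 'I_n -> 'cV[dual (quat R)]_n) b b' : dqorthonormal u ->
  (conjtr (combination u b) *m combination u b') 0 0 =
  \sum_j dqconj (b j) * b' j.
Proof.
move=> uo; rewrite /combination conjtr_sum mulmx_suml summxE.
apply: eq_bigr => i _; rewrite mulmx_sumr summxE (bigD1 i)//= big1 => [|j ji].
  by rewrite inner_vscale uo eqxx mulr1 addr0.
by rewrite inner_vscale uo eq_sym (negbTE ji) mulr0 mul0r.
Qed.

Lemma inner_self (R : realType) (n : nat) (x : 'cV[dual (quat R)]_n) :
  (conjtr x *m x) 0 0 = dq_of_dual (\sum_i dqabs (x i 0) ^+ 2).
Proof.
rewrite mxE rmorph_sum; apply: eq_bigr => i _.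
by rewrite !mxE /= mul_dqconj.
Qed.

(** Parseval: both sides are the inner product of the combination with itself,
    computed once in coordinates and once in the orthonormal family. *)
Lemma sum_dqabs_combination (R : realType) (n : nat)
    (u : 'I_n -> 'cV[dual (quat R)]_n) b : dqorthonormal u ->
  \sum_i dqabs (combination u b i 0) ^+ 2 = \sum_j dqabs (b j) ^+ 2.
Proof.
move=> uo; apply: dq_of_dual_inj; rewrite -inner_self inner_combination//.
by rewrite rmorph_sum; apply: eq_bigr => j _; rewrite mul_dqconj.
Qed.

(** The condition under which the 2-norm is a genuine square root, expressed
    on the quantity under the root. *)
Lemma mxst_neq0 (R : realType) (n : nat) (x : 'cV[dual (quat R)]_n) :
  (mxst x != 0) = (st (\sum_i dqabs (x i 0) ^+ 2) != 0).
Proof.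
congr (~~ _); rewrite st_sum psumr_eq0 => [|i _]; last first.
  by rewrite stX sqr_ge0.
apply/eqP/allP => [x0 i _|x0].
  rewrite stX sqrf_eq0/= st_dqabs qabs_eq0.
  by move/colP: x0 => /(_ i); rewrite !mxE => ->.
apply/colP => i; apply/eqP; rewrite !mxE -qabs_eq0 -st_dqabs -sqrf_eq0.
by have := x0 i (mem_index_enum i); rewrite stX.
Qed.

Lemma norm2_combination (R : realType) (n : nat)
    (u : 'I_n -> 'cV[dual (quat R)]_n) b : dqorthonormal u ->
  st (\sum_j dqabs (b j) ^+ 2) != 0 ->
  norm2 (combination u b) = dsqrt (\sum_j dqabs (b j) ^+ 2).
Proof.
by move=> uo b0; rewrite /norm2 mxst_neq0 sum_dqabs_combination// b0.
Qed.

Lemma mulmx_combination (R : comNzRingType) (n m : nat)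
    (Q : 'M[dual (quat R)]_n) (lam : 'I_m -> dual R) u b :
  (forall j, Q *m u j = vscale (u j) (dq_of_dual (lam j))) ->
  Q *m combination u b = combination u (fun j => b j * dq_of_dual (lam j)).
Proof.
move=> Qu; rewrite mulmx_sumr; apply: eq_bigr => j _.
by rewrite mulmx_vscale Qu vscaleA dq_of_dualC.
Qed.

(** * Rates up to polynomial factors *)

Local Open Scope classical_set_scope.

(** The polynomial is normalized to C (k + 1)^d, which absorbs any other one.
    Such factors are nonnegative and nondecreasing in d, and their products have
    the same form; this makes closure under sums and products immediate. *)
Definition rate (R : realType) (g a : nat -> R) : Prop :=
  exists C d, 0 <= C /\
    \forall k \near \oo, `|a k| <= C * k.+1%:R ^+ d * `|g k|.

Lemma rate_near (R : realType) (g a b : nat -> R) :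
  (\forall k \near \oo, `|a k| <= `|b k|) -> rate g b -> rate g a.
Proof.
move=> ab [C [d [C0 bC]]]; exists C, d; split=> //.
by apply: filterS2 ab bC => k; apply: le_trans.
Qed.

Lemma rate_weaken (R : realType) (g g' a : nat -> R) :
  (forall k, `|g k| <= `|g' k|) -> rate g a -> rate g' a.
Proof.
move=> gg' [C [d [C0 aC]]]; exists C, d; split=> //.
apply: filterS aC => k /le_trans; apply.
by apply: ler_wpM2l => //; rewrite mulr_ge0 ?exprn_ge0.
Qed.

Lemma rate0 (R : realType) (g : nat -> R) : rate g (fun=> 0).
Proof.
exists 0, 0%N; split=> //.
by apply: nearW => k; rewrite normr0 !mul0r.
Qed.

Lemma rate_add (R : realType) (g a b : nat -> R) :
  rate g a -> rate g b -> rate g (fun k => a k + b k).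
Proof.
move=> [C [d [C0 aC]]] [C' [d' [C'0 bC]]].
exists (C + C'), (d + d')%N; split; first exact: addr_ge0.
apply: filterS2 aC bC => k ak bk; apply: le_trans (ler_normD _ _) _.
rewrite !mulrDl; have k1 : 1 <= k.+1%:R :> R by rewrite ler1n.
apply: lerD; [apply: le_trans ak _ | apply: le_trans bk _];
  apply: ler_wpM2r => //; apply: ler_wpM2l => //;
  by apply: ler_weXn2l => //; rewrite ?leq_addr ?leq_addl.
Qed.

Lemma rate_mul (R : realType) (g a b : nat -> R) :
  rate (fun=> 1) a -> rate g b -> rate g (fun k => a k * b k).
Proof.
move=> [C [d [C0 aC]]] [C' [d' [C'0 bC]]].
exists (C * C'), (d + d')%N; split; first exact: mulr_ge0.
apply: filterS2 aC bC => k; rewrite normr1 mulr1 normrM => ak bk.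
apply: le_trans (ler_pM _ _ ak bk) _ => //.
by rewrite exprD le_eqVlt; apply/orP; left; apply/eqP; ring.
Qed.

Lemma rate_bounded (R : realType) (M : R) (a : nat -> R) :
  (forall k, `|a k| <= M) -> rate (fun=> 1) a.
Proof.
move=> aM; exists M, 0%N; split; first exact: le_trans (aM 0%N).
by apply: nearW => k; rewrite normr1 expr0 !mulr1.
Qed.

Lemma rate_scale (R : realType) (g a : nat -> R) (x : R) :
  rate g a -> rate g (fun k => x * a k).
Proof. by apply: rate_mul; apply: (@rate_bounded _ `|x|). Qed.

Lemma rate_opp (R : realType) (g a : nat -> R) :
  rate g a -> rate g (fun k => - a k).
Proof. by apply: rate_near; apply: nearW => k; rewrite normrN. Qed.

Lemma rate_inv (R : realType) (m : R) (a : nat -> R) :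
  0 < m -> (forall k, m <= a k) -> rate (fun=> 1) (fun k => (a k)^-1).
Proof.
move=> m0 ma; apply: (@rate_bounded _ m^-1) => k.
have ak : 0 < a k := lt_le_trans m0 (ma k).
by rewrite normfV gtr0_norm// lef_pV2 ?posrE.
Qed.

Lemma rate_sqrt (R : realType) (a : nat -> R) :
  rate (fun=> 1) a -> rate (fun=> 1) (fun k => Num.sqrt (a k)).
Proof.
move=> ra; apply: (@rate_near _ _ _ (fun k => 1 + a k ^+ 2)).
  apply: nearW => k; rewrite !ger0_norm ?addr_ge0 ?sqr_ge0//.
  have [a0|/ltr0_sqrtr->] := leP 0 (a k); last by rewrite addr_ge0 ?sqr_ge0.
  have := sqr_sqrtr a0; move: (Num.sqrt _) (sqrtr_ge0 (a k)) => t t0 <-.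
  have := sqr_ge0 (t - 1); have := sqr_ge0 (t ^+ 2 - 1); nra.
apply: rate_add; first exact: (@rate_bounded _ `|1|).
exact: rate_mul.
Qed.

Lemma Otilde_rate (R : realType) (g a : nat -> R) : rate g a -> Otilde g a.
Proof.
move=> [C [d [C0 aC]]]; exists (('X + 1) ^+ d); apply/eqO_exP.
exists (C + 1) => /=; first by rewrite ltr_pwDr.
apply: filterS aC => k /le_trans; apply.
rewrite !hornerE natr1 normrM [`|_ ^+ d|]ger0_norm ?exprn_ge0//.
rewrite (mulrC `|g k|) mulrA; apply: ler_wpM2r => //.
by apply: ler_wpM2r; rewrite ?exprn_ge0// lerDl.
Qed.

(** Each of the k + 1 terms of 1 + p + ... + p^k is at least p^k, and this
    sum is (1 - p^(k+1)) / (1 - p). *)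
Lemma natr_exprn_le (R : realType) (p : R) k : 0 <= p -> p < 1 ->
  k.+1%:R * p ^+ k <= (1 - p)^-1.
Proof.
move=> p0 p1; rewrite -[leRHS]mul1r ler_pdivlMr ?subr_gt0//.
have := subrX1 p k.+1 => /(congr1 -%R); rewrite opprB -mulNr opprB => e.
apply: le_trans (_ : _ <= 1 - p ^+ k.+1) _; last first.
  by rewrite gerBl exprn_ge0.
rewrite e mulrC; apply: ler_wpM2l; first by rewrite subr_ge0 ltW.
rewrite mulr_natl -[k.+1 in leLHS]card_ord -sumr_const.
by apply: ler_sum => i _; rewrite ler_wiXn2l ?(ltW p1)// -ltnS.
Qed.

(** Induction on d for all ratios at once: with p = sqrt q, one factor
    (k + 1) p^k is bounded and (k + 1)^d p^k tends to 0 by induction. *)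
Lemma cvg_natr_exprn (R : realType) (d : nat) (q : R) : 0 <= q -> q < 1 ->
  (fun k => k.+1%:R ^+ d * q ^+ k) @ \oo --> (0 : R).
Proof.
elim: d q => [|d IH] q q0 q1.
  under eq_fun do rewrite expr0 mul1r.
  by apply: cvg_expr; rewrite ger0_norm.
have p0 := sqrtr_ge0 q; have pq := sqr_sqrtr q0.
have p1 : Num.sqrt q < 1 by rewrite -sqrtr1 ltr_sqrt.
move: (Num.sqrt q) p0 pq p1 => p p0 pq p1.
have := cvgM (cvg_cst (1 - p)^-1) (IH p p0 p1); rewrite mulr0 => /(_ _ _) h0.
apply: (@squeeze_cvgr _ _ _ _ (cst 0) _ _ _ _ (cvg_cst _) h0).
apply: nearW => k; rewrite mulr_ge0 ?exprn_ge0//=.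
rewrite (_ : _ * _ = k.+1%:R * p ^+ k * (k.+1%:R ^+ d * p ^+ k)).
  by apply: ler_wpM2r; rewrite ?natr_exprn_le// mulr_ge0 ?exprn_ge0.
by rewrite -pq exprAC exprS expr2; ring.
Qed.

Lemma rate_cvg0 (R : realType) (c : R) (a : nat -> R) : 0 <= c -> c < 1 ->
  rate (fun k => c ^+ k) a -> a @ \oo --> (0 : R).
Proof.
move=> c0 c1 [C [d [C0 aC]]].
have := cvgM (cvg_cst C) (cvg_natr_exprn d c0 c1); rewrite mulr0 => /(_ _ _) h0.
have := cvgN h0; rewrite oppr0 => /(_ _) h1.
apply: (squeeze_cvgr _ h1 h0).
apply: filterS aC => k; rewrite [`|c ^+ k|]ger0_norm ?exprn_ge0// => ak.
by rewrite /= -ler_norml; apply: le_trans ak _; rewrite -mulrA.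
Qed.

(** * Rates of dual numbers *)

Definition rateD (R : realType) (g : nat -> R) (a : nat -> dual R) : Prop :=
  rate g (fun k => st (a k)) /\ rate g (fun k => du (a k)).

Lemma OtildeD_rate (R : realType) (g : nat -> R) (a : nat -> dual R) :
  rateD g a -> OtildeD g a.
Proof. by case=> ? ?; split; apply: Otilde_rate. Qed.

Lemma rateD_weaken (R : realType) (g g' : nat -> R) (a : nat -> dual R) :
  (forall k, `|g k| <= `|g' k|) -> rateD g a -> rateD g' a.
Proof. by move=> gg' [? ?]; split; apply: (rate_weaken gg'). Qed.

Lemma rateD_add (R : realType) (g : nat -> R) (a b : nat -> dual R) :
  rateD g a -> rateD g b -> rateD g (fun k => a k + b k).
Proof. by move=> [? ?] [? ?]; split; apply: rate_add. Qed.

Lemma rateD_opp (R : realType) (g : nat -> R) (a : nat -> dual R) :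
  rateD g a -> rateD g (fun k => - a k).
Proof. by move=> [? ?]; split; apply: rate_opp. Qed.

Lemma rateD_mul (R : realType) (g : nat -> R) (a b : nat -> dual R) :
  rateD (fun=> 1) a -> rateD g b -> rateD g (fun k => a k * b k).
Proof.
move=> [? ?] [? ?]; split; first exact: rate_mul.
by apply: rate_add; apply: rate_mul.
Qed.

Lemma rateD_cst (R : realType) (x : dual R) : rateD (fun=> 1) (fun=> x).
Proof.
by split; [apply: (@rate_bounded _ `|st x|)|apply: (@rate_bounded _ `|du x|)].
Qed.

(** Stated for an arbitrary property of sequences, so that it serves dual
    numbers and dual quaternions alike. *)
Lemma closed_sum (V : nmodType) (K : (nat -> V) -> Prop) :
  K (fun=> 0) -> (forall a b, K a -> K b -> K (fun k => a k + b k)) ->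
  forall (I : Type) (r : seq I) (P : pred I) F, (forall i, P i -> K (F i)) ->
  K (fun k => \sum_(i <- r | P i) F i k).
Proof.
move=> K0 KD I r P F KF; elim: r => [|i r IH].
  rewrite (_ : (fun k => _) = fun=> 0)//.
  by apply/funext => k; rewrite big_nil.
rewrite (_ : (fun k => _) =
  fun k => if P i then F i k + \sum_(j <- r | P j) F j k
           else \sum_(j <- r | P j) F j k).
  by case: (boolP (P i)) => // Pi; apply: KD => //; apply: KF.
by apply/funext => k; rewrite big_cons.
Qed.

Lemma rateD_sum (R : realType) (g : nat -> R) (I : Type) (r : seq I)
    (P : pred I) (F : I -> nat -> dual R) :
  (forall i, P i -> rateD g (F i)) ->
  rateD g (fun k => \sum_(i <- r | P i) F i k).
Proof.
apply: closed_sum => [|a b]; last exact: rateD_add.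
by split; apply: rate0.
Qed.

Lemma rateD_inv (R : realType) (m : R) (a : nat -> dual R) :
  0 < m -> (forall k, m <= st (a k)) -> rateD (fun=> 1) a ->
  rateD (fun=> 1) (fun k => dual_inv (a k)).
Proof.
move=> m0 ma [_ ra]; have ri := rate_inv m0 ma; split=> //=.
by apply: rate_opp; apply: rate_mul (rate_mul ra ri) ri.
Qed.

Lemma rateD_sqrt (R : realType) (m : R) (a : nat -> dual R) :
  0 < m -> (forall k, m <= st (a k)) -> rateD (fun=> 1) a ->
  rateD (fun=> 1) (fun k => dsqrt (a k)).
Proof.
move=> m0 ma [rs rd]; split; first exact: rate_sqrt.
apply: rate_mul => //; apply: (@rate_inv _ (2 * Num.sqrt m)).
  by rewrite mulr_gt0 ?sqrtr_gt0.
move=> k; apply: ler_wpM2l => //; rewrite ler_sqrt//.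
by apply: le_trans (ma k); apply: ltW.
Qed.

(** Rate 1 means polynomial growth; a reciprocal square root keeps it as long as
    the standard part of the argument stays away from 0. *)
Lemma rateD_inv_sqrt (R : realType) (m : R) (a : nat -> dual R) :
  0 < m -> (forall k, m <= st (a k)) -> rateD (fun=> 1) a ->
  rateD (fun=> 1) (fun k => dual_inv (dsqrt (a k))).
Proof.
move=> m0 ma ra; apply: (@rateD_inv _ (Num.sqrt m)).
- by rewrite sqrtr_gt0.
- by move=> k; rewrite /= ler_sqrt// (le_trans (ltW m0)).
- exact: (rateD_sqrt m0 ma ra).
Qed.

(** With x = sqrt A and y = sqrt (A + E_k), rationalizing gives
    x / y - 1 = - E_k / (y (x + y)), whose denominator has standard part at least
    that of y^2, hence at least that of A. *)
Lemma rateD_sqrt_ratio (R : realType) (g : nat -> R) (A : dual R)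
    (E : nat -> dual R) :
  (forall k, `|g k| <= 1) -> 0 < st A -> (forall k, 0 <= st (E k)) ->
  rateD g E ->
  rateD g (fun k => dsqrt A * dual_inv (dsqrt (A + E k)) - 1).
Proof.
move=> g1 A0 E0 rateE; set x := dsqrt A; pose y k := dsqrt (A + E k).
have AE k : st A <= st (A + E k) by rewrite /= lerDl.
have AE0 k : 0 < st (A + E k) := lt_le_trans A0 (AE k).
have x2 : x ^+ 2 = A by rewrite dsqrt_sqr.
have y2 k : y k ^+ 2 = A + E k by rewrite dsqrt_sqr.
have yV k : y k * dual_inv (y k) = 1.
  by rewrite dual_mulV// gt_eqF// sqrtr_gt0.
have rateAE : rateD (fun=> 1) (fun k => A + E k).
  apply: rateD_add; first exact: rateD_cst.
  by apply: rateD_weaken rateE => k; rewrite normr1.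
have rate_y : rateD (fun=> 1) y := rateD_sqrt A0 AE rateAE.
pose d k := y k * (x + y k).
have st_d k : st A <= st (d k).
  rewrite (_ : d k = x * y k + y k ^+ 2); last by rewrite /d; ring.
  by rewrite y2; apply: le_trans (AE k) _; rewrite lerDr /= mulr_ge0 ?sqrtr_ge0.
have dV k : d k * dual_inv (d k) = 1.
  by rewrite dual_mulV// gt_eqF// (lt_le_trans A0).
rewrite (_ : (fun k => _ - 1) = fun k => - dual_inv (d k) * E k).
  apply: rateD_mul => //; apply/rateD_opp/(rateD_inv A0 st_d).
  by apply: rateD_mul => //; apply: rateD_add => //; apply: rateD_cst.
apply/funext => k; rewrite -/(y k).
have -> : E k = y k ^+ 2 - x ^+ 2 by rewrite x2 y2 addrC addKr.
rewrite -[LHS]mulr1 -[X in _ * X = _](dV k).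
transitivity (dual_inv (d k) * ((x * (y k * dual_inv (y k)) - y k) *
  (x + y k))); first by rewrite /d; ring.
by rewrite yV; ring.
Qed.

Lemma du_exprn (R : comNzRingType) (x : dual R) k :
  du (x ^+ k) = k%:R * st x ^+ k.-1 * du x.
Proof.
elim: k => [|k IH]; first by rewrite expr0 mul0r mul0r.
rewrite exprS /= IH stX -natr1; case: k {IH} => [|k] /=; first by ring.
by rewrite exprS; ring.
Qed.

(** The dual part of x^k is k (st x)^(k-1) (du x).  For c > 0 this is at most
    (|du x| / c) k c^k; for c = 0 it vanishes as soon as k >= 2, which is why
    rates only constrain large k. *)
Lemma rateD_exprn (R : realType) (c : R) (x : dual R) :
  `|st x| <= c -> rateD (fun k => c ^+ k) (fun k => x ^+ k).
Proof.
move=> xc; have c0 : 0 <= c by apply: le_trans xc.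
split.
  exists 1, 0%N; split=> //; apply: nearW => k.
  by rewrite expr0 !mul1r stX !normrX (ger0_norm c0) lerXn2r ?nnegrE.
rewrite (_ : (fun k => du _) = fun k => k%:R * st x ^+ k.-1 * du x); last first.
  by apply/funext => k; rewrite du_exprn.
move: c0; rewrite le_eqVlt => /orP[/eqP c0|c0].
  have /eqP -> : st x == 0 by rewrite -normr_le0 c0.
  exists 0, 0%N; split=> //; near=> k.
  have k1 : (1 < k)%N by near: k; exists 2%N.
  rewrite -(prednK (ltnW k1)) /= -subn1 expr0n subn_eq0 leqNgt k1.
  by rewrite mulr0 mul0r normr0 !mul0r.
exists (`|du x| / c), 1%N; split; first by rewrite divr_ge0// ltW.
apply: nearW => k; rewrite expr1 normrX (gtr0_norm c0).
case: k => [|k]; first by rewrite !mul0r normr0 !mulr_ge0 ?invr_ge0// ltW.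
rewrite !normrM normrX normr_nat/= exprS.
rewrite (_ : _ / c * _ * _ = k.+2%:R * c ^+ k * `|du x|); last first.
  by field; rewrite gt_eqF.
apply: ler_wpM2r => //; apply: ler_pM; rewrite ?exprn_ge0// ?ler_nat//.
by rewrite lerXn2r ?nnegrE// ltW.
Unshelve. all: by end_near. Qed.

(** * Rates of dual quaternions *)

(** Componentwise rather than through the magnitude, so that sums and products
    with a fixed quaternion reduce to real sequences. *)
Definition rateQ (R : realType) (g : nat -> R) (q : nat -> quat R) : Prop :=
  [/\ rate g (fun k => qre (q k)), rate g (fun k => qi (q k)),
      rate g (fun k => qj (q k)) & rate g (fun k => qk (q k))].

(** The magnitude is at most the sum of the absolute values of the components. *)
Lemma rate_qabs (R : realType) (g : nat -> R) (q : nat -> quat R) :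
  rateQ g q -> rate g (fun k => qabs (q k)).
Proof.
case=> ra rb rc rd; have rN f : rate g f -> rate g (fun k => `|f k|).
  by apply: rate_near; apply: nearW => k; rewrite normr_id.
apply: rate_near (rate_add (rate_add (rN _ ra) (rN _ rb))
                           (rate_add (rN _ rc) (rN _ rd))).
apply: nearW => k; rewrite [leLHS]ger0_norm ?sqrtr_ge0//.
rewrite -sqrtr_sqr ler_sqrt ?sqr_ge0// -[in leLHS](real_normK (num_real (qre _))).
rewrite -(real_normK (num_real (qi _))) -(real_normK (num_real (qj _))).
rewrite -(real_normK (num_real (qk _))).
have := normr_ge0 (qre (q k)); have := normr_ge0 (qi (q k)).
have := normr_ge0 (qj (q k)); have := normr_ge0 (qk (q k)).
move: `|qre _| `|qi _| `|qj _| `|qk _| => a b c d d0 c0 b0 a0.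
rewrite -subr_ge0.
rewrite (_ : _ - _ = 2 * (a * (b + c + d) + b * (c + d) + c * d)); last ring.
by rewrite mulr_ge0// !addr_ge0// mulr_ge0// ?addr_ge0.
Qed.

Definition rateDQ (R : realType) (g : nat -> R) (x : nat -> dual (quat R)) :=
  rateQ g (fun k => st (x k)) /\ rateQ g (fun k => du (x k)).

Lemma OtildeDQ_rate (R : realType) (g : nat -> R) (x : nat -> dual (quat R)) :
  rateDQ g x -> OtildeDQ g x.
Proof. by case=> ? ?; split; apply: Otilde_rate; apply: rate_qabs. Qed.

Lemma dqcvg_rate (R : realType) (c : R) (x : nat -> dual (quat R)) y :
  0 <= c -> c < 1 -> rateDQ (fun k => c ^+ k) (fun k => x k - y) -> dqcvg x y.
Proof.
by move=> c0 c1 [? ?]; split; apply: (rate_cvg0 c0 c1); apply: rate_qabs.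
Qed.

Lemma rateDQ_scale (R : realType) (g : nat -> R) (p : dual (quat R))
    (a : nat -> dual R) :
  rateD g a -> rateDQ g (fun k => p * dq_of_dual (a k)).
Proof.
case: p => [[p0 p1 p2 p3] [q0 q1 q2 q3]] [rs rd].
have h x y : rate g (fun k => x * du (a k) + y * st (a k)).
  by apply: rate_add; apply: rate_scale.
split; split=> /=; [apply: rate_near (rate_scale p0 rs)|
 apply: rate_near (rate_scale p1 rs)|apply: rate_near (rate_scale p2 rs)|
 apply: rate_near (rate_scale p3 rs)| apply: rate_near (h p0 q0)|
 apply: rate_near (h p1 q1)| apply: rate_near (h p2 q2)|
 apply: rate_near (h p3 q3)];
 by apply: nearW => k; rewrite le_eqVlt; apply/orP; left; apply/eqP;
    congr `|_|; ring.
Qed.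

Lemma rateDQ_sum (R : realType) (g : nat -> R) (I : Type) (r : seq I)
    (P : pred I) (F : I -> nat -> dual (quat R)) :
  (forall i, P i -> rateDQ g (F i)) ->
  rateDQ g (fun k => \sum_(i <- r | P i) F i k).
Proof.
apply: closed_sum => [|a b]; first by split; split; apply: rate0.
by move=> [[? ? ? ?] [? ? ? ?]] [[? ? ? ?] [? ? ? ?]];
  split; split; apply: rate_add.
Qed.

Local Close Scope classical_set_scope.

(** * The power method *)

(** Only the ratios to lam1 are tracked: after renormalization the powers of
    lam1 itself cancel up to the sign of its standard part.  The unit norm of
    the initial vector says T_0 = 1, which starts the induction. *)
Lemma power_method_iterates (R : realType) (n : nat)
    (Q : 'M[dual (quat R)]_n) (lam1 : dual R) (r : 'I_n -> dual R)
    (u : 'I_n -> 'cV[dual (quat R)]_n) (alpha : 'I_n -> dual (quat R))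
    (v y : nat -> 'cV[dual (quat R)]_n) :
  dqorthonormal u ->
  (forall j, Q *m u j = vscale (u j) (dq_of_dual (lam1 * r j))) ->
  st lam1 != 0 ->
  v 0%N = combination u alpha -> norm2 (v 0%N) = 1 ->
  (forall k, y k.+1 = Q *m v k) ->
  (forall k, v k.+1 = vdiv (y k.+1) (norm2 (y k.+1))) ->
  let T := fun k => \sum_j dqabs (alpha j) ^+ 2 * r j ^+ (2 * k) in
  (forall k, 0 < st (T k)) ->
  forall k, v k = combination u (fun j => alpha j *
    dq_of_dual (Dual (Num.sg (st lam1)) 0 ^+ k * r j ^+ k
                * dual_inv (dsqrt (T k)))).
Proof.
move=> uo Qu lam0 v0 nv0 yE vE T T0.
set s : dual R := Dual (Num.sg (st lam1)) 0.
have ss : s * s = 1.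
  apply: dual_eqP => /=; last by rewrite mulr0 mul0r addr0.
  by rewrite -expr2 sqr_sg lam0.
have sqT k : dsqrt (T k) ^+ 2 = T k by rewrite dsqrt_sqr.
have st_sqT k : 0 < st (dsqrt (T k)) by rewrite sqrtr_gt0.
have sqTV k : dsqrt (T k) * dual_inv (dsqrt (T k)) = 1.
  by rewrite dual_mulV// gt_eqF.
have lamV := dual_mulV lam0.
elim=> [|k IH].
  have T1 : T 0%N = \sum_j dqabs (alpha j) ^+ 2.
    by apply: eq_bigr => j _; rewrite muln0 expr0 mulr1.
  have sqT0 : dsqrt (T 0%N) = 1.
    by rewrite -nv0 v0 norm2_combination -?T1// gt_eqF.
  rewrite v0; apply: eq_bigr => j _; congr vscale.
  by rewrite sqT0 (@dual_inv_uniq _ 1 1) ?mulr1// !expr0 mulr1 rmorph1 mulr1.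
set t := dual_inv (dsqrt (T k)) in IH; set t' := dual_inv (dsqrt (T k.+1)).
have tt : dsqrt (T k) * t = 1 := sqTV k.
have tt' : dsqrt (T k.+1) * t' = 1 := sqTV k.+1.
have yk : y k.+1 = combination u (fun j => alpha j *
    dq_of_dual (s ^+ k * r j ^+ k.+1 * t * lam1)).
  rewrite yE IH (mulmx_combination _ Qu); apply: eq_bigr => j _.
  congr vscale; rewrite -mulrA -rmorphM; congr (_ * dq_of_dual _).
  by rewrite exprS; ring.
(* s * lam1 has positive standard part, so that N is the square root of N^2. *)
pose N := s * lam1 * t * dsqrt (T k.+1).
have N0 : 0 < st N.
  have : 0 < Num.sg (st lam1) * st lam1 by rewrite -normrEsg normr_gt0.
  move=> ?; apply: mulr_gt0; last exact: st_sqT.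
  by apply: mulr_gt0 => //; rewrite /= invr_gt0; apply: st_sqT.
have NE : \sum_j dqabs (alpha j *
    dq_of_dual (s ^+ k * r j ^+ k.+1 * t * lam1)) ^+ 2 = N ^+ 2.
  have -> : N ^+ 2 = (t * lam1) ^+ 2 * T k.+1.
    by rewrite -sqT -[RHS]mul1r -ss /N; ring.
  rewrite mulr_sumr; apply: eq_bigr => j _; rewrite dqabs_sqrM.
  have sk : (s ^+ k) ^+ 2 = 1 by rewrite exprAC expr2 ss expr1n.
  rewrite [(2 * k.+1)%N]mulnC exprM !exprMn sk; ring.
have nyk : norm2 (y k.+1) = N.
  rewrite yk norm2_combination// NE ?dsqrt_of_sqr//.
  by rewrite stX sqrf_eq0 gt_eqF.
have NV : dual_inv N = s * dual_inv lam1 * dsqrt (T k) * t'.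
  apply: dual_inv_uniq.
  transitivity ((s * s) * (lam1 * dual_inv lam1) * (dsqrt (T k) * t) *
     (dsqrt (T k.+1) * t')); first by rewrite /N; ring.
  by rewrite ss lamV tt tt' !mulr1.
rewrite vE nyk vdivE yk vscale_combination; apply: eq_bigr => j _.
congr vscale; rewrite -mulrA -rmorphM; congr (_ * dq_of_dual _); rewrite NV.
transitivity (s ^+ k.+1 * r j ^+ k.+1 * t' * (lam1 * dual_inv lam1) *
  (dsqrt (T k) * t)); last by rewrite lamV tt !mulr1.
by rewrite !exprS; ring.
Qed.

Theorem theorem4p1 (R : realType) (n : nat)
    (Q : 'M[dual (quat R)]_n.+1)
    (lam : 'I_n.+1 -> dual R)
    (u : 'I_n.+1 -> 'cV[dual (quat R)]_n.+1)
    (alpha : 'I_n.+1 -> dual (quat R))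
    (l : nat)
    (v y : nat -> 'cV[dual (quat R)]_n.+1)
    (mu : nat -> dual (quat R)) :
  dqhermitian Q ->
  (forall j, is_eigenvector Q (lam j) (u j)) ->
  dqorthonormal u ->
  v 0%N = \sum_j vscale (u j) (alpha j) ->
  norm2 (v 0%N) = 1 ->
  \sum_(j < n.+1 | (j < l)%N) qabs (st (alpha j)) != 0 ->
  mxst Q != 0 ->
  strict_dominant lam l ->
  (forall k, y k.+1 = Q *m v k) ->
  (forall k, mu k = (conjtr (v k) *m y k.+1) 0 0) ->
  (forall k, v k.+1 = vdiv (y k.+1) (norm2 (y k.+1))) ->
  let s := Num.sg (st (lam ord0)) in
  let c := `|next_st lam l / st (lam ord0)| in
  let gamma := fun j : 'I_n.+1 =>
    dqdiv (alpha j)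
      (dsqrt (\sum_(i < n.+1 | (i < l)%N) dqabs (alpha i) ^+ 2)) in
  let w := \sum_(j < n.+1 | (j < l)%N) vscale (u j) (gamma j) in
  [/\ (exists delta : 'I_n.+1 -> nat -> dual R,
       exists rho : 'I_n.+1 -> nat -> dual (quat R),
       [/\ forall j, OtildeD (fun k => c ^+ k) (delta j),
           forall j, OtildeDQ (fun k => c ^+ k) (rho j) &
           forall k, v k =
             vscale (\sum_(j < n.+1 | (j < l)%N)
                       vscale (u j) (gamma j * dq_of_dual (1 + delta j k)))
                    (dq_of_real (s ^+ k))
             + \sum_(j < n.+1 | (l <= j)%N) vscale (u j) (rho j k)]),
      (exists delta : nat -> dual R,
         OtildeD (fun k => c ^+ (2 * k)) delta /\
         forall k, mu k = dq_of_dual (lam ord0 * (1 + delta k))),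
      is_eigenvector Q (lam ord0) w,
      (dvcvg (fun k => vscale (v k) (dq_of_real (s ^+ k))) w /\
       OtildeDV (fun k => c ^+ k)
         (fun k => vscale (v k) (dq_of_real (s ^+ k)) - w)) &
      (dqcvg mu (dq_of_dual (lam ord0)) /\
       OtildeDQ (fun k => c ^+ (2 * k))
         (fun k => mu k - dq_of_dual (lam ord0)))].
Proof.
move=> _ Qu uo v0 nv0 alpha0 _ [/andP[l0 ln] lamE ltst lest] yE muE vE s c gamma w.
have lam0 : st (lam ord0) != 0.
  by rewrite -normr_gt0; apply: le_lt_trans ltst.
have c0 : 0 <= c by exact: normr_ge0.
have c1 : c < 1 by rewrite /c normf_div ltr_pdivrMr ?normr_gt0// mul1r.
have s2 : s ^+ 2 = 1 by rewrite sqr_sg lam0.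
pose r j := lam j * dual_inv (lam ord0).
have lamV := dual_mulV lam0.
have rE j : lam ord0 * r j = lam j by rewrite mulrCA lamV mulr1.
have r1 (j : 'I_n.+1) : (j < l)%N -> r j = 1 by move=> jl; rewrite /r lamE.
have r_le (j : 'I_n.+1) : (l <= j)%N -> `|st (r j)| <= c.
  (* The hypothesis lj makes l a valid index, excluding the default 0 of next_st. *)
  move=> lj; rewrite /r /= /c !normrM ler_wpM2r// /next_st.
  case: insubP => [i _ il|]; last by rewrite (leq_ltn_trans lj).
  by apply: lest; rewrite il leqnn.
pose A := \sum_(i < n.+1 | (i < l)%N) dqabs (alpha i) ^+ 2.
pose E k := \sum_(j < n.+1 | (l <= j)%N) dqabs (alpha j) ^+ 2 * r j ^+ (2 * k).
pose T k := \sum_j dqabs (alpha j) ^+ 2 * r j ^+ (2 * k).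
have TE k : T k = A + E k.
  rewrite /T (bigID (fun j : 'I_n.+1 => (j < l)%N)) /=; congr (_ + _).
    by apply: eq_bigr => j jl; rewrite r1// expr1n mulr1.
  by apply: eq_bigl => j; rewrite -leqNgt.
have A0 : 0 < st A.
  rewrite /A st_sum lt0r sumr_ge0 ?andbT => [|j _]; last by rewrite stX sqr_ge0.
  apply: contra alpha0; rewrite psumr_eq0 => [/allP A0|j _]; last first.
    by rewrite stX sqr_ge0.
  apply/eqP/big1 => j jl; apply/eqP.
  have := A0 j (mem_index_enum j).
  by rewrite jl stX sqrf_eq0 st_dqabs.
have E0 k : 0 <= st (E k).
  rewrite /E st_sum sumr_ge0// => j _.
  by rewrite mulnC exprM -exprMn stX sqr_ge0.
have TA k : st A <= st (T k) by rewrite TE /= lerDl.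
have T0 k : 0 < st (T k) by apply: lt_le_trans (TA k).
have Qu' j : Q *m u j = vscale (u j) (dq_of_dual (lam ord0 * r j)).
  by rewrite rE; case: (Qu j).
have vk := power_method_iterates uo Qu' lam0 v0 nv0 yE vE T0.
rewrite -/s -/(T _) in vk.
pose x := dsqrt A; pose z k := dual_inv (dsqrt (T k)).
have x0 : st x != 0 by rewrite gt_eqF// sqrtr_gt0.
have xV := dual_mulV x0.
have x2 : x ^+ 2 = A by rewrite dsqrt_sqr.
have zV k : dsqrt (T k) * z k = 1 by rewrite dual_mulV// gt_eqF// sqrtr_gt0.
have gammaE j : gamma j = alpha j * dq_of_dual (dual_inv x) by rewrite /gamma dqdivE.
pose S : dual R := Dual s 0.
have Sk k : Dual (s ^+ k) 0 = S ^+ k.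
  elim: k => [|k IH]; first by rewrite !expr0.
  by rewrite [RHS]exprS -IH; apply: dual_eqP; rewrite /= ?exprS// mulr0 mul0r addr0.
have s1 : S * S = 1.
  by apply: dual_eqP; rewrite /= -?expr2 ?s2// mulr0 mul0r addr0.
have SS k : S ^+ k * S ^+ k = 1 by rewrite -exprMn s1 expr1n.
have {}vk k : v k =
    combination u (fun j => alpha j * dq_of_dual (S ^+ k * r j ^+ k * z k)).
  exact: vk.
have realS k : dq_of_real (s ^+ k) = dq_of_dual (S ^+ k) by rewrite -Sk.
have rate_r2 (j : 'I_n.+1) : (l <= j)%N ->
    rateD (fun k => c ^+ (2 * k)) (fun k => r j ^+ (2 * k)).
  move=> lj; rewrite (_ : (fun k => c ^+ _) = fun k => (c ^+ 2) ^+ k); last first.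
    by apply/funext => k; rewrite exprM.
  rewrite (_ : (fun k => r j ^+ _) = fun k => (r j ^+ 2) ^+ k); last first.
    by apply/funext => k; rewrite exprM.
  by apply: rateD_exprn; rewrite stX normrX lerXn2r ?nnegrE ?r_le.
have rateE : rateD (fun k => c ^+ (2 * k)) E.
  by apply: rateD_sum => j lj; apply: rateD_mul; [apply: rateD_cst|apply: rate_r2].
have bounded1 k : `|c ^+ (2 * k)| <= `|1| :> R.
  by rewrite normr1 normrX ger0_norm// exprn_ile1// ltW.
have c2kk k : `|c ^+ (2 * k)| <= `|c ^+ k|.
  rewrite !ger0_norm ?exprn_ge0// ler_wiXn2l// ?(ltW c1)//.
  by rewrite mul2n -addnn leq_addr.
have rateT : rateD (fun=> 1) T.
  rewrite (_ : T = fun k => A + E k); last by apply/funext.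
  by apply: rateD_add; [apply: rateD_cst|apply: rateD_weaken rateE].
have rate_z : rateD (fun=> 1) z := rateD_inv_sqrt A0 TA rateT.
pose delta k := x * z k - 1.
have rate_delta : rateD (fun k => c ^+ (2 * k)) delta.
  rewrite (_ : delta = fun k => x * dual_inv (dsqrt (A + E k)) - 1).
    by apply: rateD_sqrt_ratio => // k; rewrite -(normr1 R).
  by apply/funext => k; rewrite -TE.
have rate_delta1 : rateD (fun k => c ^+ k) delta by apply: rateD_weaken rate_delta.
have rate_S : rateD (fun=> 1) (fun k => S ^+ k).
  apply: (@rateD_weaken _ (fun k => 1 ^+ k)).
    by move=> k; rewrite expr1n.
  by apply: rateD_exprn; rewrite /= /s normr_sg lam0.
have rate_r (j : 'I_n.+1) : (l <= j)%N ->
    rateD (fun k => c ^+ k) (fun k => z k * r j ^+ k).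
  by move=> lj; apply: rateD_mul => //; apply: rateD_exprn; apply: r_le.
have part1 : exists delta : 'I_n.+1 -> nat -> dual R,
       exists rho : 'I_n.+1 -> nat -> dual (quat R),
       [/\ forall j, OtildeD (fun k => c ^+ k) (delta j),
           forall j, OtildeDQ (fun k => c ^+ k) (rho j) &
           forall k, v k =
             vscale (\sum_(j < n.+1 | (j < l)%N)
                       vscale (u j) (gamma j * dq_of_dual (1 + delta j k)))
                    (dq_of_real (s ^+ k))
             + \sum_(j < n.+1 | (l <= j)%N) vscale (u j) (rho j k)].
  exists (fun=> delta).
  exists (fun (j : 'I_n.+1) k => if (l <= j)%N
    then alpha j * dq_of_dual (S ^+ k * (z k * r j ^+ k)) else 0).
  split=> [j|j|k]; first exact: OtildeD_rate.
    apply: OtildeDQ_rate; case: leqP => lj; last first.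
      by split; split; apply: rate0.
    by apply: rateDQ_scale; apply: rateD_mul => //; apply: rate_r.
  rewrite vk /combination (bigID (fun j : 'I_n.+1 => (j < l)%N)) /=; congr (_ + _).
    rewrite vscale_sumr; apply: eq_bigr => j jl; rewrite vscaleA realS gammaE.
    congr vscale; rewrite -!mulrA -!rmorphM; congr (_ * dq_of_dual _).
    rewrite r1// expr1n /delta addrC subrK.
    transitivity (S ^+ k * z k * (x * dual_inv x)); first by rewrite xV; ring.
    by ring.
  apply: eq_big => [j|j]; rewrite -leqNgt// => lj; rewrite lj.
  by congr (vscale _ (_ * dq_of_dual _)); rewrite -/(z k); ring.
(* F splits off the leading term: T_k + F_k = sum_j |alpha_j|^2 r_j^(2k+1), the
   numerator of the Rayleigh quotient divided by lambda_1. *)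
pose F k := \sum_(j < n.+1 | (l <= j)%N)
  dqabs (alpha j) ^+ 2 * (r j - 1) * r j ^+ (2 * k).
pose eta k := z k * z k * F k.
have rate_eta : rateD (fun k => c ^+ (2 * k)) eta.
  apply: rateD_mul; first exact: rateD_mul.
  by apply: rateD_sum => j lj; apply: rateD_mul; [apply: rateD_cst|apply: rate_r2].
have mu_eta k : mu k = dq_of_dual (lam ord0 * (1 + eta k)).
  have TF : T k + F k = \sum_j dqabs (alpha j) ^+ 2 * r j ^+ (2 * k) * r j.
    rewrite /F big_mkcond -big_split /=; apply: eq_bigr => j _.
    by case: leqP => jl; [|rewrite r1//]; ring.
  have zzT : z k * z k * T k = 1.
    rewrite -(dsqrt_sqr (T0 k)).
    transitivity ((dsqrt (T k) * z k) ^+ 2); first by ring.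
    by rewrite zV expr1n.
  rewrite muE yE vk (mulmx_combination _ Qu') inner_combination//.
  rewrite -[X in X + eta k]zzT -mulrDr TF !mulr_sumr rmorph_sum.
  apply: eq_bigr => j _; rewrite mulrA mul_dqconj dqabs_sqrM -rmorphM.
  congr dq_of_dual; rewrite mulnC exprM -[RHS]mul1r -(SS k).
  by ring.
have wE : w = combination u (fun j => if (j < l)%N then gamma j else 0).
  rewrite /w big_mkcond; apply: eq_bigr => j _; case: ifP => // _.
  by apply/colP => i; rewrite !mxE mulr0.
have part3 : is_eigenvector Q (lam ord0) w.
  split; last first.
    rewrite mulmx_sumr vscale_sumr; apply: eq_bigr => j jl.
    by rewrite mulmx_vscale (Qu j).2 !vscaleA dq_of_dualC lamE.
  rewrite mxst_neq0 wE sum_dqabs_combination//.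
  rewrite (_ : \sum_j _ = 1) ?oner_neq0//.
  transitivity (A * dual_inv x ^+ 2); last first.
    by rewrite -x2 -exprMn xV expr1n.
  rewrite /A mulr_suml [RHS]big_mkcond; apply: eq_bigr => j _.
  case: ifP => _; first by rewrite gammaE dqabs_sqrM.
  by apply: dq_of_dual_inj; rewrite -mul_dqconj mulr0 rmorph0.
have rate_v i : rateDQ (fun k => c ^+ k)
    (fun k => vscale (v k) (dq_of_real (s ^+ k)) i 0 - w i 0).
  (* e j k is the deviation of the j-th coefficient from its limit, with the
     fixed quaternion alpha_j taken out. *)
  pose e (j : 'I_n.+1) k :=
    if (j < l)%N then dual_inv x * delta k else z k * r j ^+ k.
  rewrite (_ : (fun k => _) =
    fun k => \sum_j u j i 0 * alpha j * dq_of_dual (e j k)).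
    apply: rateDQ_sum => j _; apply: rateDQ_scale; rewrite /e.
    case: ltnP => jl; last exact: rate_r.
    by apply: rateD_mul => //; apply: rateD_cst.
  apply/funext => k; rewrite realS vk vscale_combination wE /combination.
  rewrite !summxE -sumrB; apply: eq_bigr => j _; rewrite !mxE -mulrBr -[RHS]mulrA.
  congr (_ * _); rewrite -mulrA -rmorphM -/(z k).
  have -> : S ^+ k * r j ^+ k * z k * S ^+ k = z k * r j ^+ k.
    by rewrite -[RHS]mul1r -(SS k); ring.
  rewrite /e; case: ifP => jl; last by rewrite subr0.
  rewrite gammaE -mulrBr -rmorphB; congr (_ * dq_of_dual _).
  rewrite r1// expr1n.
  transitivity (x * dual_inv x * z k - dual_inv x); first by rewrite xV; ring.
  by rewrite /delta; ring.
have rate_mu : rateDQ (fun k => c ^+ (2 * k))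
    (fun k => mu k - dq_of_dual (lam ord0)).
  rewrite (_ : (fun k => _ - _) =
    fun k => dq_of_dual (lam ord0) * dq_of_dual (eta k)).
    exact: rateDQ_scale.
  by apply/funext => k; rewrite mu_eta -rmorphB -rmorphM; congr dq_of_dual; ring.
split=> //.
- by exists eta; split=> //; apply: OtildeD_rate.
- split=> i; first exact: (dqcvg_rate c0 c1).
  rewrite (_ : (fun k => _) =
    fun k => vscale (v k) (dq_of_real (s ^+ k)) i 0 - w i 0).
    exact: OtildeDQ_rate.
  by apply/funext => k; rewrite !mxE.
- split; last exact: OtildeDQ_rate.
  have c20 : 0 <= c ^+ 2 by rewrite exprn_ge0.
  have c21 : c ^+ 2 < 1 by rewrite exprn_ilt1.
  apply: (dqcvg_rate c20 c21).
  rewrite (_ : (fun k => _ ^+ k) = fun k => c ^+ (2 * k))//.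
  by apply/funext => k; rewrite exprM.
Qed.
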